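(* Let $\Theta\vdash P::\Gamma$ be derivable in CHOP. Then $\cdot\vdash[\![P]\!]::[\![\Theta]\!],[\![\Gamma]\!]$ is derivable in CP.
   Context: CHOP (Classical Higher-Order Processes). Channel names $x,y,z,\dots$; process variables $p,q,r$; parameter labels $l$; type variables $X$. A parameter record $\rho=\{l_1=x_1,\dots,l_k=x_k\}$ maps distinct labels to channels. Processes: $x[y].(P\mid Q)\mid x(y).P\mid x[\mathsf{inl}].P\mid x[\mathsf{inr}].P\mid x.\mathsf{case}(P,Q)\mid ?x[y].P\mid !x(y).P\mid x[A].P\mid x(X).P\mid x[\lambda\rho.P]$ (send an abstraction, which binds the image of $\rho$, required to be exactly the free channels of $P$) $\mid x(p).P$ (receive abstraction into $p$) $\mid p\langle\rho\rangle$ (run) $\mid x[\,]\mid x().P\mid x.\mathsf{case}()\mid x\leftrightarrow^A y\mid(\nu x^Ay)(P\mid Q)\mid\mathsf{let}\ p=\lambda\rho.Q\ \mathsf{in}\ P$ (explicit substitution). In $x[y].(P\mid Q)$, $x(y).P$, $?x[y].P$, $!x(y).P$, $y$ is bound in $P$. Session types: $A\otimes B\mid A⅋B\mid A\oplus B\mid A\&B\mid0\mid\top\mid1\mid\bot\mid ?A\mid !A\mid\exists X.A\mid\forall X.A\mid X\mid X^\perp\mid\mathsf{send}(\Gamma)\mid\mathsf{recv}(\Gamma)$; a process type $\Gamma=s_1:A_1,\dots,s_n:A_n$ maps distinct keys (labels or channels) to types, order irrelevant. Duality $A^\perp$ is the standard linear-logic duality ($\otimes/⅋$, $\oplus/\&$,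 $0/\top$, $1/\bot$, $?/!$, $\exists/\forall$, $X/X^\perp$ swapped, e.g. $(A\otimes B)^\perp=A^\perp⅋B^\perp$, $(?A)^\perp=!(A^\perp)$) extended by $\mathsf{send}(\Gamma)^\perp=\mathsf{recv}(\Gamma)$ and $\mathsf{recv}(\Gamma)^\perp=\mathsf{send}(\Gamma)$. $\Gamma\rho$ renames labels via $\rho$; $?\Gamma$ means all types in $\Gamma$ are of form $?A$. A process environment $\Theta=p_1:\Gamma_1,\dots,p_n:\Gamma_n$ (distinct variables); $\cdot$ empty. CHOP typing rules for $\Theta\vdash P::\Gamma$: (Axiom) $\cdot\vdash x\leftrightarrow^A y::x:A^\perp,y:A$. (Cut) $\Theta\vdash P::\Gamma,x:A$, $\Theta'\vdash Q::\Delta,y:A^\perp$ give $\Theta,\Theta'\vdash(\nu x^Ay)(P\mid Q)::\Gamma,\Delta$. ($\otimes$) $\Theta\vdash P::\Gamma,y:A$, $\Theta'\vdash Q::\Delta,x:B$ give $\Theta,\Theta'\vdash x[y].(P\mid Q)::\Gamma,\Delta,x:A\otimes B$. ($⅋$) $\Theta\vdash P::\Gamma,y:A,x:B$ gives $\Theta\vdash x(y).P::\Gamma,x:A⅋B$. ($\oplus_{1,2}$) $\Theta\vdash P::\Gamma,x:A$ (resp. $B$) gives $\Theta\vdash x[\mathsf{inl}].P$ (resp. $x[\mathsf{inr}].P$) $::\Gamma,x:A\oplus B$. ($\&$) $\Theta\vdash P::\Gamma,x:A$, $\Theta\vdash Q::\Gamma,x:B$ give $\Theta\vdash x.\mathsf{case}(P,Q)::\Gamma,x:A\&B$.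 ($?$) $\Theta\vdash P::\Gamma,y:A$ gives $\Theta\vdash ?x[y].P::\Gamma,x:?A$. ($!$) $\cdot\vdash P::?\Gamma,y:A$ gives $\cdot\vdash !x(y).P::?\Gamma,x:!A$. ($\exists$) $\Theta\vdash P::\Gamma,x:B\{A/X\}$ gives $\Theta\vdash x[A].P::\Gamma,x:\exists X.B$. ($\forall$) $\Theta\vdash P::\Gamma,x:B$, $X$ not free in $\Theta,\Gamma$, gives $\Theta\vdash x(X).P::\Gamma,x:\forall X.B$. (Weaken) $\Theta\vdash P::\Gamma$ gives $\Theta\vdash P::\Gamma,x:?A$. (Contract) $\Theta\vdash P::\Gamma,y:?A,z:?A$ gives $\Theta\vdash P\{x/y,x/z\}::\Gamma,x:?A$. ($1$) $\cdot\vdash x[\,]::x:1$. ($\bot$) $\Theta\vdash P::\Gamma$ gives $\Theta\vdash x().P::\Gamma,x:\bot$. ($\top$) $\Theta\vdash x.\mathsf{case}()::\Gamma,x:\top$. (Id) $p:\Gamma\vdash p\langle\rho\rangle::\Gamma\rho$. (Chop) $\Theta\vdash P::\Delta\rho$, $\Theta',p:\Delta\vdash Q::\Gamma$ give $\Theta,\Theta'\vdash\mathsf{let}\ p=\lambda\rho.P\ \mathsf{in}\ Q::\Gamma$. ($\mathsf{send}$) $\Theta\vdash P::\Gamma\rho$ gives $\Theta\vdash x[\lambda\rho.P]::x:\mathsf{send}(\Gamma)$. ($\mathsf{recv}$) $\Theta,p:\Delta\vdash P::\Gamma$ gives $\Theta\vdash x(p).P::\Gamma,x:\mathsf{recv}(\Delta)$.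 CP is the fragment of CHOP without the types $\mathsf{send}(\Gamma),\mathsf{recv}(\Gamma)$, without the terms $x[\lambda\rho.P]$, $x(p).P$, $p\langle\rho\rangle$ and explicit substitutions, whose typing rules are those above except Id, Chop, $\mathsf{send}$, $\mathsf{recv}$, with the process environment removed (always empty). In CP, free output $x[y].P$ abbreviates $x[z].(y\leftrightarrow z\mid P)$ ($z$ fresh). Type translation: $[\![\mathsf{send}(\Delta)]\!]=([\![\Delta]\!])^\perp\otimes 1$; $[\![\mathsf{recv}(\Delta)]\!]=[\![\Delta]\!]⅋\bot$; for a label-keyed $\Delta=(l_1:A_1,\dots,l_n:A_n)$ with labels in lexicographic order, $[\![\Delta]\!]=[\![A_1^\perp]\!]\otimes\cdots\otimes[\![A_n^\perp]\!]\otimes 1$; all other connectives, units, atoms and quantifiers are translated homomorphically ($[\![A\otimes B]\!]=[\![A]\!]\otimes[\![B]\!]$, $[\![X]\!]=X$, $[\![?A]\!]=?[\![A]\!]$, $[\![\exists X.A]\!]=\exists X.[\![A]\!]$, etc.). For channel-keyed $\Gamma$, $[\![\Gamma]\!]$ translates each type pointwise. For process environments: $[\![\cdot]\!]=\cdot$ and $[\![\Theta,p:\Delta]\!]=[\![\Theta]\!],x^p:[\![\Delta]\!]$, where $\{x^p\}$ is a family of channel names, one per process variable $p$, not otherwise used. Process translation $[\![\cdot]\!]$, defined on CHOP typing derivations (records $\rho=\{l_1=z_1,\dots,l_k=z_k\}$ listed in lexicographic order of labels): Chop with premises for $P$ and $Q$ ending in $\mathsf{let}\ p=\lambda\rho.P\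 \mathsf{in}\ Q$ $\mapsto(\nu x^p\,y^p)([\![Q]\!]\mid y^p(z_1).\cdots.y^p(z_k).y^p().[\![P]\!])$ (restriction typed $[\![\Delta]\!]$); Id $p\langle\rho\rangle\mapsto x^p[z_1].\cdots.x^p[z_k].x^p[\,]$ (free outputs); $\mathsf{send}$: $x[\lambda\rho.P]\mapsto x[y].(y(z_1).\cdots.y(z_k).y().[\![P]\!]\mid x[\,])$; $\mathsf{recv}$: $x(p).Q\mapsto x(x^p).x().[\![Q]\!]$; Axiom $x\leftrightarrow^A y\mapsto x\leftrightarrow^{[\![A]\!]}y$; Cut $(\nu x^Ay)(P\mid Q)\mapsto(\nu x^{[\![A]\!]}y)([\![P]\!]\mid[\![Q]\!])$; $\exists$: $x[A].P\mapsto x[[\![A]\!]].[\![P]\!]$; Weaken $\mapsto$ the translation of the premise; Contract $\mapsto$ the translation of the premise with $x$ substituted for $y$ and $z$; every other rule maps its term constructor to the same constructor applied to the translations of the premises (e.g. $x[y].(P\mid Q)\mapsto x[y].([\![P]\!]\mid[\![Q]\!])$, $x.\mathsf{case}(P,Q)\mapsto x.\mathsf{case}([\![P]\!],[\![Q]\!])$, $x[\,]\mapsto x[\,]$, $x.\mathsf{case}()\mapsto x.\mathsf{case}()$). *)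

(* Defs.v *)
From HB Require Import structures.
From mathcomp Require Import all_boot all_order finmap.

Set Implicit Arguments.
Unset Strict Implicit.
Unset Printing Implicit Defensive.

Import Order.TTheory.
Local Open Scope fset_scope.
Local Open Scope fmap_scope.

Definition chan : choiceType := nat.
Definition pvar : choiceType := nat.
Definition tvar : choiceType := nat.
(* Labels are words over a countable alphabet; [<=%O] on [label] is their
   lexicographic order. *)
Definition label : orderType _ := seqlexi nat.

(* The flag [ho] selects the calculus everywhere below: [true] is CHOP and
   [false] is CP.  The constructors and typing rules that take an argument of
   type [is_true ho] are the higher-order ones, so they do not exist in CP.

   Syntax is taken up to alpha-equivalence, as a nested datatype over the type
   of its free names: under a binder of one name that type becomes an [option]
   type, in which [None] is the bound name. *)

Inductive ty (ho : bool) (T : Type) : Type :=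
| Tensor (A B : ty ho T)
| Par (A B : ty ho T)
| Plus (A B : ty ho T)
| With (A B : ty ho T)
| Zero
| Top
| One
| Bot
| Why (A : ty ho T)
| Bang (A : ty ho T)
| Ex (A : ty ho (option T))
| All (A : ty ho (option T))
| Var (X : T)
| NVar (X : T)                                     (* dual of a variable *)
| Send (_ : ho) (G : {fmap label -> ty ho T})
| Recv (_ : ho) (G : {fmap label -> ty ho T}).

Arguments Zero {ho T}.
Arguments Top {ho T}.
Arguments One {ho T}.
Arguments Bot {ho T}.
Arguments Var {ho T} X.
Arguments NVar {ho T} X.

Fixpoint dual ho (T : Type) (A : ty ho T) : ty ho T :=
  match A with
  | Tensor A B => Par (dual A) (dual B)
  | Par A B => Tensor (dual A) (dual B)
  | Plus A B => With (dual A) (dual B)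
  | With A B => Plus (dual A) (dual B)
  | Zero => Top
  | Top => Zero
  | One => Bot
  | Bot => One
  | Why A => Bang (dual A)
  | Bang A => Why (dual A)
  | Ex A => All (dual A)
  | All A => Ex (dual A)
  | Var X => NVar X
  | NVar X => Var X
  | Send h G => Recv h G
  | Recv h G => Send h G
  end.

Fixpoint map_ty ho (T U : Type) (f : T -> U) (A : ty ho T) : ty ho U :=
  match A with
  | Tensor A B => Tensor (map_ty f A) (map_ty f B)
  | Par A B => Par (map_ty f A) (map_ty f B)
  | Plus A B => Plus (map_ty f A) (map_ty f B)
  | With A B => With (map_ty f A) (map_ty f B)
  | Zero => Zero
  | Top => Top
  | One => One
  | Bot => Bot
  | Why A => Why (map_ty f A)
  | Bang A => Bang (map_ty f A)
  | Ex A => Ex (map_ty (omap f) A)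
  | All A => All (map_ty (omap f) A)
  | Var X => Var (f X)
  | NVar X => NVar (f X)
  | Send h G => Send h [fmap l : domf G => map_ty f (G l)]
  | Recv h G => Recv h [fmap l : domf G => map_ty f (G l)]
  end.

Definition lift_ty ho (T U : Type) (f : T -> ty ho U) (X : option T)
  : ty ho (option U) :=
  if X is Some Y then map_ty Some (f Y) else Var None.

(* Simultaneous capture-avoiding substitution of types for type variables. *)
Fixpoint bind_ty ho (T U : Type) (f : T -> ty ho U) (A : ty ho T) : ty ho U :=
  match A with
  | Tensor A B => Tensor (bind_ty f A) (bind_ty f B)
  | Par A B => Par (bind_ty f A) (bind_ty f B)
  | Plus A B => Plus (bind_ty f A) (bind_ty f B)
  | With A B => With (bind_ty f A) (bind_ty f B)
  | Zero => Zero
  | Top => Top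
  | One => One
  | Bot => Bot
  | Why A => Why (bind_ty f A)
  | Bang A => Bang (bind_ty f A)
  | Ex A => Ex (bind_ty (lift_ty f) A)
  | All A => All (bind_ty (lift_ty f) A)
  | Var X => f X
  | NVar X => dual (f X)
  | Send h G => Send h [fmap l : domf G => bind_ty f (G l)]
  | Recv h G => Recv h [fmap l : domf G => bind_ty f (G l)]
  end.

(* [subst_ty X A B] is B{A/X}. *)
Definition subst_ty ho (X : tvar) (A B : ty ho tvar) : ty ho tvar :=
  bind_ty (fun Y => if Y == X then A else Var Y) B.

Fixpoint free_tvar ho (T : Type) (X : T) (A : ty ho T) : Prop :=
  match A with
  | Tensor A B | Par A B | Plus A B | With A B =>
      free_tvar X A \/ free_tvar X B
  | Zero | Top | One | Bot => False
  | Why A | Bang A => free_tvar X A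
  | Ex A | All A => free_tvar (Some X) A
  | Var Y | NVar Y => X = Y
  | Send _ G | Recv _ G => exists l : domf G, free_tvar X (G l)
  end.

(* [C], [V] and [T] are the types of free channels, process variables and type
   variables.  An abstraction [\rho.P] is stored as the label set [L] of rho
   together with P in which the channel that rho assigns to the label l is
   replaced by [inl l]. *)
Inductive proc (ho : bool) (C V T : Type) : Type :=
| Out (x : C) (P : proc ho (option C) V T) (Q : proc ho C V T)
                                                   (* x[y].(P | Q) *)
| In (x : C) (P : proc ho (option C) V T)          (* x(y).P *)
| Inl (x : C) (P : proc ho C V T)                  (* x[inl].P *)
| Inr (x : C) (P : proc ho C V T)                  (* x[inr].P *)
| Case (x : C) (P Q : proc ho C V T)               (* x.case(P, Q) *)
| Request (x : C) (P : proc ho (option C) V T)     (* ?x[y].P *)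
| Serve (x : C) (P : proc ho (option C) V T)       (* !x(y).P *)
| OutTy (x : C) (A : ty ho T) (P : proc ho C V T)  (* x[A].P *)
| InTy (x : C) (P : proc ho C V (option T))        (* x(X).P *)
| OutAbs (_ : ho) (x : C) (L : {fset label}) (P : proc ho (L + C) V T)
                                                   (* x[\rho.P] *)
| InAbs (_ : ho) (x : C) (P : proc ho C (option V) T)
                                                   (* x(p).P *)
| Run (_ : ho) (p : V) (rho : {fmap label -> C})   (* p<rho> *)
| Close (x : C)                                    (* x[] *)
| Wait (x : C) (P : proc ho C V T)                 (* x().P *)
| Absurd (x : C)                                   (* x.case() *)
| Link (x : C) (A : ty ho T) (y : C)               (* x <->^A y *)
| New (A : ty ho T) (P Q : proc ho (option C) V T)
                     (* (nu x^A y)(P | Q), x bound in P and y bound in Q *)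
| Let (_ : ho) (L : {fset label}) (P : proc ho (L + C) V T)
    (Q : proc ho C (option V) T).                  (* let p = \rho.P in Q *)

Arguments Close {ho C V T} x.
Arguments Absurd {ho C V T} x.
Arguments Link {ho C V T} x A y.
Arguments Run {ho C V T} _ p rho.

Definition map_inr (L C C' : Type) (f : C -> C') (z : L + C) : L + C' :=
  match z with inl l => inl l | inr c => inr (f c) end.

Fixpoint map_proc ho (C C' V V' T T' : Type)
    (f : C -> C') (g : V -> V') (h : T -> T') (P : proc ho C V T)
  : proc ho C' V' T' :=
  match P with
  | Out x P Q => Out (f x) (map_proc (omap f) g h P) (map_proc f g h Q)
  | In x P => In (f x) (map_proc (omap f) g h P)
  | Inl x P => Inl (f x) (map_proc f g h P)
  | Inr x P => Inr (f x) (map_proc f g h P)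
  | Case x P Q => Case (f x) (map_proc f g h P) (map_proc f g h Q)
  | Request x P => Request (f x) (map_proc (omap f) g h P)
  | Serve x P => Serve (f x) (map_proc (omap f) g h P)
  | OutTy x A P => OutTy (f x) (map_ty h A) (map_proc f g h P)
  | InTy x P => InTy (f x) (map_proc f g (omap h) P)
  | OutAbs k x L P => OutAbs k (f x) (map_proc (map_inr f) g h P)
  | InAbs k x P => InAbs k (f x) (map_proc f (omap g) h P)
  | Run k p rho => Run k (g p) [fmap l : domf rho => f (rho l)]
  | Close x => Close (f x)
  | Wait x P => Wait (f x) (map_proc f g h P)
  | Absurd x => Absurd (f x)
  | Link x A y => Link (f x) (map_ty h A) (f y)
  | New A P Q =>
      New (map_ty h A) (map_proc (omap f) g h P) (map_proc (omap f) g h Q)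
  | Let k L P Q =>
      Let k (map_proc (map_inr f) g h P) (map_proc f (omap g) h Q)
  end.

Fixpoint free_chan ho (C V T : Type) (z : C) (P : proc ho C V T) : Prop :=
  match P with
  | Out x P Q => z = x \/ free_chan (Some z) P \/ free_chan z Q
  | In x P | Request x P | Serve x P => z = x \/ free_chan (Some z) P
  | Inl x P | Inr x P | OutTy x _ P | Wait x P => z = x \/ free_chan z P
  | InTy x P => z = x \/ free_chan z P
  | Case x P Q => z = x \/ free_chan z P \/ free_chan z Q
  | OutAbs _ x L P => z = x \/ free_chan (inr z) P
  | InAbs _ x P => z = x \/ free_chan z P
  | Run _ _ rho => exists l : domf rho, z = rho l
  | Close x | Absurd x => z = x
  | Link x _ y => z = x \/ z = y
  | New _ P Q => free_chan (Some z) P \/ free_chan (Some z) Q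
  | Let _ L P Q => free_chan (inr z) P \/ free_chan z Q
  end.

Notation cproc ho := (proc ho chan pvar tvar).
Notation record := {fmap label -> chan}.

(* Binding a name: [absC y P] is the body "y.P" of a binder of y. *)
Definition abs_name (K : eqType) (x y : K) : option K :=
  if y == x then None else Some y.

Definition abs_ty ho (X : tvar) (A : ty ho tvar) : ty ho (option tvar) :=
  map_ty (abs_name X) A.

Definition absC ho (y : chan) (P : cproc ho) : proc ho (option chan) pvar tvar :=
  map_proc (abs_name y) id id P.

Definition absV ho (p : pvar) (P : cproc ho) : proc ho chan (option pvar) tvar :=
  map_proc id (abs_name p) id P.

Definition absT ho (X : tvar) (P : cproc ho) : proc ho chan pvar (option tvar) :=
  map_proc id id (abs_name X) P.

Definition absR ho (rho : record) (P : cproc ho)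
  : proc ho (domf rho + chan) pvar tvar :=
  map_proc
    (fun z => if [pick l : domf rho | rho l == z] is Some l then inl l
              else inr z) id id P.

(* P{x/y, x/z} *)
Definition contract_proc ho (x y z : chan) (P : cproc ho) : cproc ho :=
  map_proc (fun c => if (c == y) || (c == z) then x else c) id id P.

(* Process types inside types and in process environments are keyed by labels;
   the one to the right of the turnstile is keyed by channels. *)
Notation ptype ho := {fmap label -> ty ho tvar}.
Notation env ho := {fmap chan -> ty ho tvar}.
Notation penv ho := {fmap pvar -> ptype ho}.

(* Apply the partial renaming [f] to the keys of [G]; it is used only where [f]
   is defined and injective on the keys of [G]. *)
Definition rekey (K K' : choiceType) (V : Type) (f : K -> option K') (G : {fmap K -> V})
  : {fmap K' -> V} :=
  foldr (fun k D => if (f k, G.[? k]) is (Some k', Some v) then D.[k' <- v]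
                    else D)
        [fmap] (domf G).

(* Gamma rho *)
Definition instantiate ho (G : ptype ho) (rho : record) : env ho :=
  rekey (fun l => rho.[? l]) G.

(* Gamma rho is a channel-keyed process type with one channel per label of
   Gamma, which rho lists. *)
Definition fits ho (rho : record) (G : ptype ho) : Prop :=
  domf rho = domf G /\ injective rho.

(* The well-formedness requirement on an abstraction \rho.P. *)
Definition closes ho (rho : record) (P : cproc ho) : Prop :=
  forall z, free_chan z P <-> exists l : domf rho, z = rho l.

Definition all_why ho (G : env ho) : Prop :=
  forall x : domf G, exists A, G x = Why A.

Definition fresh_in ho (K : choiceType) (X : tvar) (G : {fmap K -> ty ho tvar})
  : Prop :=
  forall k : domf G, ~ free_tvar X (G k).

Definition fresh_in_penv ho (X : tvar) (Th : penv ho) : Prop :=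
  forall p : domf Th, fresh_in X (Th p).

(* [deriv Th P G] is the type of derivations of Th |- P :: G.  The side
   conditions on names say that every comma joins disjoint environments. *)
Inductive deriv (ho : bool) : penv ho -> cproc ho -> env ho -> Type :=
| d_axiom x y A :
    x != y ->
    deriv [fmap] (Link x A y) [fmap].[x <- dual A].[y <- A]
| d_cut Th Th' G D x y A P Q :
    x \notin domf G -> y \notin domf D ->
    [disjoint domf G & domf D] -> [disjoint domf Th & domf Th'] ->
    deriv Th P G.[x <- A] ->
    deriv Th' Q D.[y <- dual A] ->
    deriv (Th + Th') (New A (absC x P) (absC y Q)) (G + D)
| d_tensor Th Th' G D x y A B P Q :
    y \notin domf G -> x \notin domf G -> x \notin domf D ->
    [disjoint domf G & domf D] -> [disjoint domf Th & domf Th'] ->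
    deriv Th P G.[y <- A] ->
    deriv Th' Q D.[x <- B] ->
    deriv (Th + Th') (Out x (absC y P) Q) (G + D).[x <- Tensor A B]
| d_par Th G x y A B P :
    y \notin domf G -> x \notin domf G -> x != y ->
    deriv Th P G.[y <- A].[x <- B] ->
    deriv Th (In x (absC y P)) G.[x <- Par A B]
| d_plus1 Th G x A B P :
    x \notin domf G ->
    deriv Th P G.[x <- A] ->
    deriv Th (Inl x P) G.[x <- Plus A B]
| d_plus2 Th G x A B P :
    x \notin domf G ->
    deriv Th P G.[x <- B] ->
    deriv Th (Inr x P) G.[x <- Plus A B]
| d_with Th G x A B P Q :
    x \notin domf G ->
    deriv Th P G.[x <- A] ->
    deriv Th Q G.[x <- B] ->
    deriv Th (Case x P Q) G.[x <- With A B]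
| d_why Th G x y A P :
    y \notin domf G -> x \notin domf G ->
    deriv Th P G.[y <- A] ->
    deriv Th (Request x (absC y P)) G.[x <- Why A]
| d_bang G x y A P :
    y \notin domf G -> x \notin domf G -> all_why G ->
    deriv [fmap] P G.[y <- A] ->
    deriv [fmap] (Serve x (absC y P)) G.[x <- Bang A]
| d_ex Th G x X A B P :
    x \notin domf G ->
    deriv Th P G.[x <- subst_ty X A B] ->
    deriv Th (OutTy x A P) G.[x <- Ex (abs_ty X B)]
| d_all Th G x X B P :
    x \notin domf G -> fresh_in_penv X Th -> fresh_in X G ->
    deriv Th P G.[x <- B] ->
    deriv Th (InTy x (absT X P)) G.[x <- All (abs_ty X B)]
| d_weaken Th G x A P :
    x \notin domf G ->
    deriv Th P G ->
    deriv Th P G.[x <- Why A]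
| d_contract Th G x y z A P :
    y \notin domf G -> z \notin domf G -> y != z -> x \notin domf G ->
    deriv Th P G.[y <- Why A].[z <- Why A] ->
    deriv Th (contract_proc x y z P) G.[x <- Why A]
| d_one x :
    deriv [fmap] (Close x) [fmap].[x <- One]
| d_bot Th G x P :
    x \notin domf G ->
    deriv Th P G ->
    deriv Th (Wait x P) G.[x <- Bot]
| d_top Th G x :
    x \notin domf G ->
    deriv Th (Absurd x) G.[x <- Top]
| d_id (h : ho) p G rho :
    fits rho G ->
    deriv [fmap].[p <- G] (Run h p rho) (instantiate G rho)
| d_chop (h : ho) Th Th' G D p rho P Q :
    fits rho D -> closes rho P -> p \notin domf Th' ->
    [disjoint domf Th & domf Th'] ->
    deriv Th P (instantiate D rho) ->
    deriv Th'.[p <- D] Q G ->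
    deriv (Th + Th') (Let h (absR rho P) (absV p Q)) G
| d_send (h : ho) Th G x rho P :
    fits rho G -> closes rho P ->
    deriv Th P (instantiate G rho) ->
    deriv Th (OutAbs h x (absR rho P)) [fmap].[x <- Send h G]
| d_recv (h : ho) Th G D x p P :
    x \notin domf G -> p \notin domf Th ->
    deriv Th.[p <- D] P G ->
    deriv Th (InAbs h x (absV p P)) G.[x <- Recv h D].

Definition derivable ho (Th : penv ho) (P : cproc ho) (G : env ho) : Prop :=
  inhabited (deriv Th P G).

(* The channels occurring in the judgements of a derivation. *)
Fixpoint chans ho (Th : penv ho) P G (d : deriv Th P G) : {fset chan} :=
  domf G `|`
  match d with
  | d_axiom _ _ _ _ | d_one _ | d_top _ _ _ _ | d_id _ _ _ _ _ => fset0
  | d_cut _ _ _ _ _ _ _ _ _ _ _ _ _ d1 d2 => chans d1 `|` chans d2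
  | d_tensor _ _ _ _ _ _ _ _ _ _ _ _ _ _ _ d1 d2 => chans d1 `|` chans d2
  | d_par _ _ _ _ _ _ _ _ _ _ d1 => chans d1
  | d_plus1 _ _ _ _ _ _ _ d1 | d_plus2 _ _ _ _ _ _ _ d1 => chans d1
  | d_with _ _ _ _ _ _ _ _ d1 d2 => chans d1 `|` chans d2
  | d_why _ _ _ _ _ _ _ _ d1 | d_bang _ _ _ _ _ _ _ _ d1 => chans d1
  | d_ex _ _ _ _ _ _ _ _ d1 | d_all _ _ _ _ _ _ _ _ _ d1 => chans d1
  | d_weaken _ _ _ _ _ _ d1 => chans d1
  | d_contract _ _ _ _ _ _ _ _ _ _ _ d1 => chans d1
  | d_bot _ _ _ _ _ d1 => chans d1
  | d_chop _ _ _ _ _ _ _ _ _ _ _ _ _ d1 d2 => chans d1 `|` chans d2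
  | d_send _ _ _ _ _ _ _ _ d1 => chans d1
  | d_recv _ _ _ _ _ _ _ _ _ d1 => chans d1
  end.

Definition labels (L : {fset label}) : seq label := sort <=%O L.

Definition tensors (T : Type) (G : {fmap label -> ty false T}) : ty false T :=
  foldr (fun l B => if G.[? l] is Some A then Tensor A B else B)
        One (labels (domf G)).

(* [tr_ty_pol false A] is the translation of A and [tr_ty_pol true A] that of
   the dual of A (see [tr_ty_polE]): the second argument makes the recursion
   structural, since the translation of Send and Recv goes through the duals of
   the types in a process type (see [tr_tySend] and [tr_tyRecv]). *)
Fixpoint tr_ty_pol (T : Type) (b : bool) (A : ty true T) : ty false T :=
  match A with
  | Tensor A B =>
      (if b then @Par _ _ else @Tensor _ _) (tr_ty_pol b A) (tr_ty_pol b B)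
  | Par A B =>
      (if b then @Tensor _ _ else @Par _ _) (tr_ty_pol b A) (tr_ty_pol b B)
  | Plus A B =>
      (if b then @With _ _ else @Plus _ _) (tr_ty_pol b A) (tr_ty_pol b B)
  | With A B =>
      (if b then @Plus _ _ else @With _ _) (tr_ty_pol b A) (tr_ty_pol b B)
  | Zero => if b then Top else Zero
  | Top => if b then Zero else Top
  | One => if b then Bot else One
  | Bot => if b then One else Bot
  | Why A => (if b then @Bang _ _ else @Why _ _) (tr_ty_pol b A)
  | Bang A => (if b then @Why _ _ else @Bang _ _) (tr_ty_pol b A)
  | Ex A => (if b then @All _ _ else @Ex _ _) (tr_ty_pol b A)
  | All A => (if b then @Ex _ _ else @All _ _) (tr_ty_pol b A)
  | Var X => if b then NVar X else Var X
  | NVar X => if b then Var X else NVar X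
  | Send _ G =>
      let D := tensors [fmap l : domf G => tr_ty_pol true (G l)] in
      if b then Par D Bot else Tensor (dual D) One
  | Recv _ G =>
      let D := tensors [fmap l : domf G => tr_ty_pol true (G l)] in
      if b then Tensor (dual D) One else Par D Bot
  end.

Definition tr_ty (T : Type) (A : ty true T) : ty false T := tr_ty_pol false A.

Definition tr_ptype (T : Type) (G : {fmap label -> ty true T}) : ty false T :=
  tensors [fmap l : domf G => tr_ty (dual (G l))].

Lemma tr_ty_polE (T : Type) (A : ty true T) : tr_ty_pol true A = tr_ty (dual A).
Proof.
rewrite /tr_ty; elim: A => //= {T} T.
all: try by move=> A -> B ->.
all: by move=> A ->.
Qed.

Lemma tr_tySend (T : Type) h (G : {fmap label -> ty true T}) :
  tr_ty (Send h G) = Tensor (dual (tr_ptype G)) One.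
Proof.
rewrite /tr_ty /tr_ptype /=; congr (Tensor (dual (tensors (FinMap _))) _).
by apply/ffunP => l; rewrite !ffunE tr_ty_polE.
Qed.

Lemma tr_tyRecv (T : Type) h (G : {fmap label -> ty true T}) :
  tr_ty (Recv h G) = Par (tr_ptype G) Bot.
Proof.
rewrite /tr_ty /tr_ptype /=; congr (Par (tensors (FinMap _)) _).
by apply/ffunP => l; rewrite !ffunE tr_ty_polE.
Qed.

Definition tr_env (G : env true) : env false :=
  [fmap x : domf G => tr_ty (G x)].

(* [xp p] is the channel x^p reserved for the process variable p. *)
Definition tr_penv (xp : pvar -> chan) (Th : penv true) : env false :=
  rekey (fun p => Some (xp p)) [fmap p : domf Th => tr_ptype (Th p)].

Definition fresh (s : {fset chan}) : chan := (\max_(x <- s) x).+1%N.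

(* z_1, ..., z_k for rho = {l_1 = z_1, ..., l_k = z_k} with l_1 < ... < l_k. *)
Definition images (rho : record) : seq chan :=
  pmap (fun l => rho.[? l]) (labels (domf rho)).

(* y(z_1). ... .y(z_k).P *)
Definition inputs (y : chan) (zs : seq chan) (P : cproc false) : cproc false :=
  foldr (fun z Q => In y (absC z Q)) P zs.

(* The free output x[y].P, that is x[z].(y <->^A z | P) with z fresh. *)
Definition free_out (x y : chan) (A : ty false tvar) (P : cproc false)
  : cproc false :=
  let z := fresh [fset x; y] in Out x (absC z (Link y A z)) P.

(* y(z_1). ... .y(z_k).y().P *)
Definition receive_record (y : chan) (rho : record) (P : cproc false)
  : cproc false :=
  inputs y (images rho) (Wait y P).

(* x[z_1]. ... .x[z_k].x[]; in x : tr_ptype G the component for the label l has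
   type tr_ty (dual (G l)), which is the type that the link must carry. *)
Definition send_record (x : chan) (G : ptype true) (rho : record)
  : cproc false :=
  foldr (fun l Q => if (G.[? l], rho.[? l]) is (Some A, Some z)
                    then free_out x z (tr_ty (dual A)) Q else Q)
        (Close x) (labels (domf rho)).

(* The channel y that the translations of Chop and send bind is fresh for all
   the channels of the translated judgement of the premise. *)
Fixpoint tr (xp : pvar -> chan) (Th : penv true) P G (d : deriv Th P G)
  : cproc false :=
  match d with
  | d_axiom x y A _ => Link x (tr_ty A) y
  | d_cut _ _ _ _ x y A _ _ _ _ _ _ d1 d2 =>
      New (tr_ty A) (absC x (tr xp d1)) (absC y (tr xp d2))
  | d_tensor _ _ _ _ x y _ _ _ _ _ _ _ _ _ d1 d2 =>
      Out x (absC y (tr xp d1)) (tr xp d2)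
  | d_par _ _ x y _ _ _ _ _ _ d1 => In x (absC y (tr xp d1))
  | d_plus1 _ _ x _ _ _ _ d1 => Inl x (tr xp d1)
  | d_plus2 _ _ x _ _ _ _ d1 => Inr x (tr xp d1)
  | d_with _ _ x _ _ _ _ _ d1 d2 => Case x (tr xp d1) (tr xp d2)
  | d_why _ _ x y _ _ _ _ d1 => Request x (absC y (tr xp d1))
  | d_bang _ x y _ _ _ _ _ d1 => Serve x (absC y (tr xp d1))
  | d_ex _ _ x _ A _ _ _ d1 => OutTy x (tr_ty A) (tr xp d1)
  | d_all _ _ x X _ _ _ _ _ d1 => InTy x (absT X (tr xp d1))
  | d_weaken _ _ _ _ _ _ d1 => tr xp d1
  | d_contract _ _ x y z _ _ _ _ _ _ d1 => contract_proc x y z (tr xp d1)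
  | d_one x => Close x
  | d_bot _ _ x _ _ d1 => Wait x (tr xp d1)
  | d_top _ _ x _ => Absurd x
  | d_id _ p G rho _ => send_record (xp p) G rho
  | d_chop _ Th1 _ _ D p rho _ _ _ _ _ _ d1 d2 =>
      let y := fresh (domf (tr_penv xp Th1) `|` domf (instantiate D rho)) in
      New (tr_ptype D) (absC (xp p) (tr xp d2))
          (absC y (receive_record y rho (tr xp d1)))
  | d_send _ Th1 G x rho _ _ _ d1 =>
      let y := fresh (x |` domf (tr_penv xp Th1) `|` domf (instantiate G rho))
      in Out x (absC y (receive_record y rho (tr xp d1))) (Close x)
  | d_recv _ _ _ _ x p _ _ _ d1 => In x (absC (xp p) (Wait x (tr xp d1)))
  end.

(* Main.v *)
(* Induction on the derivation, with the reserved channels x^p added to the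
   environment.  Run unfolds the tensor [tr_ptype G] on x^p into a chain of free
   outputs, one per label, and an abstraction unfolds the dual type into the
   matching chain of inputs, so Chop becomes a cut on [tr_ptype D].  The bound
   channel y that the translation chooses may coincide with a reserved channel,
   but not with one of the environment that it joins, which is all that the CP
   rules require. *)

Require Import Defs.
From mathcomp Require Import all_boot all_order finmap.
Local Open Scope fset_scope.
Local Open Scope fmap_scope.

Set Implicit Arguments.
Unset Strict Implicit.
Unset Printing Implicit Defensive.

(** * Lookups in finite maps, and induction on nested types *)

Lemma fnd_fmap (K : choiceType) (V W : Type) (F : V -> W) (G : {fmap K -> V})
    k :
  [fmap x : domf G => F (G x)].[? k] = omap F G.[? k].
Proof.
have [kG|kG] := boolP (k \in domf G); last by rewrite !not_fnd.
by rewrite !in_fnd /= ffunE.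
Qed.

Lemma fmap_comp (K : choiceType) (V W Z : Type) (F : V -> W) (H : W -> Z)
    (G : {fmap K -> V}) :
  [fmap x : domf G => H ([fmap x : domf G => F (G x)] x)] =
  [fmap x : domf G => H (F (G x))].
Proof. by congr FinMap; apply/ffunP => x; rewrite !ffunE. Qed.

Lemma catf_setl_notin (K : choiceType) V (f g : {fmap K -> V}) k v :
  k \notin domf g -> f.[k <- v] + g = (f + g).[k <- v].
Proof.
move=> /negPf kg; apply/fmapP => l; rewrite fnd_cat !fnd_set fnd_cat.
by case: (eqVneq l k) => // ->; rewrite kg.
Qed.

(* The automatically generated principle has no induction hypothesis for the
   types inside Send and Recv. *)
Lemma ty_nested_ind (ho : bool) (P : forall T : Type, ty ho T -> Prop) :
  (forall T A B, P T A -> P T B -> P T (Tensor A B)) ->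
  (forall T A B, P T A -> P T B -> P T (Par A B)) ->
  (forall T A B, P T A -> P T B -> P T (Plus A B)) ->
  (forall T A B, P T A -> P T B -> P T (With A B)) ->
  (forall T, P T Zero) -> (forall T, P T Top) ->
  (forall T, P T One) -> (forall T, P T Bot) ->
  (forall T A, P T A -> P T (Why A)) ->
  (forall T A, P T A -> P T (Bang A)) ->
  (forall T A, P (option T) A -> P T (Ex A)) ->
  (forall T A, P (option T) A -> P T (All A)) ->
  (forall T X, P T (Var X)) -> (forall T X, P T (NVar X)) ->
  (forall T h (G : {fmap label -> ty ho T}),
     (forall l : domf G, P T (G l)) -> P T (Send h G)) ->
  (forall T h (G : {fmap label -> ty ho T}),
     (forall l : domf G, P T (G l)) -> P T (Recv h G)) ->
  forall T A, P T A.
Proof.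
move=> H1 H2 H3 H4 H5 H6 H7 H8 H9 H10 H11 H12 H13 H14 H15 H16.
exact: (fix F T (A : ty ho T) {struct A} : P T A :=
  match A with
  | Tensor A B => H1 _ _ _ (F _ A) (F _ B)
  | Par A B => H2 _ _ _ (F _ A) (F _ B)
  | Plus A B => H3 _ _ _ (F _ A) (F _ B)
  | With A B => H4 _ _ _ (F _ A) (F _ B)
  | Zero => H5 _
  | Top => H6 _
  | One => H7 _
  | Bot => H8 _
  | Why A => H9 _ _ (F _ A)
  | Bang A => H10 _ _ (F _ A)
  | Ex A => H11 _ _ (F _ A)
  | All A => H12 _ _ (F _ A)
  | Var X => H13 _ X
  | NVar X => H14 _ X
  | Send h G => H15 _ h G (fun l => F _ (G l))
  | Recv h G => H16 _ h G (fun l => F _ (G l))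
  end).
Qed.

(** * The type translation against duality, renaming, substitution and free variables *)

(** Duality does not enter the process type inside [Send] and [Recv], so the generated induction
    principle suffices here and in the next lemmas on [dual]. *)
Lemma dualK ho T : involutive (@dual ho T).
Proof.
elim=> //= {}T; first [by move=> A -> B -> | by move=> A ->].
Qed.

Lemma dual_map ho T U (f : T -> U) (A : ty ho T) :
  dual (map_ty f A) = map_ty f (dual A).
Proof.
elim: A U f => //= {}T.
all: first [by move=> A IHA B IHB U f; rewrite IHA IHB
           |by move=> A IHA U f; rewrite IHA].
Qed.

Lemma dual_bind ho T U (f : T -> ty ho U) (A : ty ho T) :
  dual (bind_ty f A) = bind_ty f (dual A).
Proof.
elim: A U f => //= {}T.
all: first [by move=> A IHA B IHB U f; rewrite IHA IHB
           |by move=> A IHA U f; rewrite IHA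
           |by move=> X U f; rewrite dualK].
Qed.

Lemma free_tvar_dual ho T (X : T) (A : ty ho T) :
  free_tvar X (dual A) <-> free_tvar X A.
Proof.
elim: A X => //= {}T.
all: first [by move=> A IHA B IHB X; rewrite IHA IHB
           |by move=> A IHA X; rewrite IHA].
Qed.

(** Both sides are read as the two polarities of [tr_ty_pol]. These share the same tensor [D] for a
    process type, so nothing is needed about its components; only [Send] leaves a double dual. *)
Lemma tr_ty_dual T (A : ty true T) : tr_ty (dual A) = dual (tr_ty A).
Proof.
rewrite -tr_ty_polE /tr_ty; elim: A => //= {}T.
all: first [by move=> A -> B -> | by move=> A ->
           |by move=> _ G; rewrite dualK].
Qed.

Lemma map_tensors T U (f : T -> U) (G : {fmap label -> ty false T}) :
  map_ty f (tensors G) = tensors [fmap l : domf G => map_ty f (G l)].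
Proof.
rewrite /tensors /=; elim: (labels _) => //= l s IHs.
by rewrite fnd_fmap; case: G.[? l] => //= A; rewrite IHs.
Qed.

Lemma bind_tensors T U (f : T -> ty false U) (G : {fmap label -> ty false T}) :
  bind_ty f (tensors G) = tensors [fmap l : domf G => bind_ty f (G l)].
Proof.
rewrite /tensors /=; elim: (labels _) => //= l s IHs.
by rewrite fnd_fmap; case: G.[? l] => //= A; rewrite IHs.
Qed.

Lemma free_tvar_tensors T (X : T) (G : {fmap label -> ty false T}) :
  free_tvar X (tensors G) -> exists l : domf G, free_tvar X (G l).
Proof.
rewrite /tensors; elim: (labels _) => //= l s IHs.
case: fndP => // lG /= [|/IHs//].
by exists [` lG].
Qed.

(** Both polarities are treated together, because the types inside [Send] and [Recv] are translated
    at polarity [true] whatever [b] is. *)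
Lemma tr_ty_pol_map T U (f : T -> U) b (A : ty true T) :
  tr_ty_pol b (map_ty f A) = map_ty f (tr_ty_pol b A).
Proof.
elim/ty_nested_ind: A U f b => {}T.
all: first [move=> A B IHA IHB U f b | move=> h G IHG U f b | move=> A IHA U f b
           | move=> X U f b | move=> U f b].
all: case: b => /=; try by rewrite ?IHA ?IHB.
all: rewrite -?dual_map map_tensors fmap_comp //.
(* The tensor shape comes from [Send] at [false] and [Recv] at [true], the par shape from the other
   two cases. *)
all: first [congr (Tensor (dual (tensors (FinMap _))) One)
           |congr (Par (tensors (FinMap _)) Bot)].
all: by apply/ffunP => l; rewrite !ffunE IHG.
Qed.

(** The two substitutions are related only pointwise, so that the induction can pass under a
    quantifier, where [lift_tr] restores the relation. *)
Lemma tr_ty_pol_bind T U (f : T -> ty true U) g b (A : ty true T) :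
  (forall X, tr_ty (f X) = g X) ->
  tr_ty_pol b (bind_ty f A) = bind_ty g (tr_ty_pol b A).
Proof.
have lift_tr S V (f1 : S -> ty true V) g1 : (forall X, tr_ty (f1 X) = g1 X) ->
    forall X, tr_ty (lift_ty f1 X) = lift_ty g1 X.
  by move=> fg [X|] //=; rewrite /tr_ty tr_ty_pol_map -fg.
elim/ty_nested_ind: A U f g b => {}T.
all: first [move=> A B IHA IHB U f g b fg | move=> h G IHG U f g b fg
           |move=> A IHA U f g b fg | move=> X U f g b fg | move=> U f g b fg].
all: have fg' := lift_tr _ _ _ _ fg; case: b => /=.
all: try by rewrite ?(IHA _ _ _ _ fg) ?(IHA _ _ _ _ fg') ?(IHB _ _ _ _ fg).
(* The variable cases: a dual is put around [f X] by [NVar] or by polarity [true], and has to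
   commute with the translation. *)
all: rewrite ?tr_ty_polE ?dualK -/(tr_ty _) ?tr_ty_dual ?fg //.
all: rewrite -?dual_bind bind_tensors fmap_comp //.
all: first [congr (Tensor (dual (tensors (FinMap _))) One)
           |congr (Par (tensors (FinMap _)) Bot)].
all: by apply/ffunP => l; rewrite !ffunE (IHG _ _ _ _ _ fg).
Qed.

Lemma free_tvar_tr_ty_pol T (X : T) b (A : ty true T) :
  free_tvar X (tr_ty_pol b A) -> free_tvar X A.
Proof.
elim/ty_nested_ind: A X b => {}T.
all: first [move=> A B IHA IHB X b fr | move=> h G IHG X b fr
           |move=> A IHA X b fr | move=> Y X b fr | move=> X b fr].
all: case: b fr => //= fr.
all: try solve [exact: IHA fr
               |case: fr => fr; [left; exact: IHA fr | right; exact: IHB fr]].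
all: case: fr => // fr; try have {}fr := proj1 (free_tvar_dual _ _) fr.
all: have [l] := free_tvar_tensors fr.
all: by rewrite ffunE => {}fr; exists l; exact: IHG fr.
Qed.

Lemma free_tvar_tr_ptype T (X : T) (G : {fmap label -> ty true T}) :
  free_tvar X (tr_ptype G) -> exists l : domf G, free_tvar X (G l).
Proof.
move=> fr; have [l] := free_tvar_tensors fr; rewrite ffunE => {}fr.
exists l; exact: (proj1 (free_tvar_dual _ _) (free_tvar_tr_ty_pol fr)).
Qed.

Lemma tr_ty_subst X (A B : ty true tvar) :
  tr_ty (subst_ty X A B) = subst_ty X (tr_ty A) (tr_ty B).
Proof. by apply: tr_ty_pol_bind => Y; case: ifP. Qed.

Lemma tr_ty_abs X (A : ty true tvar) : tr_ty (abs_ty X A) = abs_ty X (tr_ty A).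
Proof. exact: tr_ty_pol_map. Qed.

(** * Renaming the keys of a finite map *)

(* [rekey] with an explicit list of keys, so that it can be enumerated in the
   order of the labels. *)
Definition rekey_seq (K K' : choiceType) (V : Type) (f : K -> option K')
    (G : {fmap K -> V}) (s : seq K) : {fmap K' -> V} :=
  foldr (fun k D => if (f k, G.[? k]) is (Some k', Some v) then D.[k' <- v]
                    else D) [fmap] s.

Lemma rekeyE (K K' : choiceType) V (f : K -> option K') (G : {fmap K -> V}) :
  rekey f G = rekey_seq f G (domf G).
Proof. by []. Qed.

Lemma fnd_rekey_seq (K K' : choiceType) V f (G : {fmap K -> V}) s k (k' : K') :
  f k = Some k' -> {in s, forall l, f l = Some k' -> l = k} ->
  (rekey_seq f G s).[? k'] = if k \in s then G.[? k] else None.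
Proof.
move=> fk; elim: s => [|l s IHs] inj /=; first by rewrite fnd_fmap0.
have {}IHs : (rekey_seq f G s).[? k'] = if k \in s then G.[? k] else None.
  by apply: IHs => m ms; apply: inj; rewrite inE ms orbT.
rewrite inE; case: (eqVneq k l) => [<-|kl] /=.
  rewrite fk; case Gk: G.[? k] => [v|]; first by rewrite fnd_set eqxx.
  by rewrite IHs Gk if_same.
case fl: (f l) => [l'|] //; case: G.[? l] => // v; rewrite fnd_set.
case: eqP => // e; move: kl; rewrite (inj l) ?eqxx ?inE ?eqxx //.
by rewrite fl e.
Qed.

Lemma rekey_seq_dom (K K' : choiceType) V f (G : {fmap K -> V}) s (k' : K') :
  k' \in domf (rekey_seq f G s) -> exists2 k, k \in s & f k = Some k'.
Proof.
elim: s => [|l s IHs] /=; first by rewrite inE.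
have cons : k' \in domf (rekey_seq f G s) ->
    exists2 k, k \in l :: s & f k = Some k'.
  by case/IHs=> k ks fk; exists k; rewrite // inE ks orbT.
case fl: (f l) => [l'|] //; case: G.[? l] => // v.
rewrite dom_setf => /fset1UP [->|//].
by exists l; rewrite // inE eqxx.
Qed.

(** With no collision between keys, no insertion overwrites another, so the order of insertion is
    immaterial. This trades the arbitrary enumeration of a domain for the lexicographic one. *)
Lemma eq_rekey_seq (K K' : choiceType) V (f : K -> option K')
    (G : {fmap K -> V}) (s t : seq K) : s =i t ->
  {in s &, forall k l, f k = f l -> k = l} -> rekey_seq f G s = rekey_seq f G t.
Proof.
move=> st inj; apply/fmapP => k'.
have fnd u : u =i s -> forall k, k \in s -> f k = Some k' ->
    (rekey_seq f G u).[? k'] = G.[? k].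
  move=> us k ks fk; rewrite (@fnd_rekey_seq _ _ _ _ _ _ k) ?us ?ks // => l.
  by rewrite us => ls fl; apply: inj; rewrite // fl.
have [/rekey_seq_dom [k ks fk]|k's] := boolP (k' \in domf (rekey_seq f G s)).
  by rewrite !(fnd _ _ k).
have [/rekey_seq_dom [k ks fk]|k't] := boolP (k' \in domf (rekey_seq f G t)).
  by rewrite !(fnd _ _ k) // st.
by rewrite !not_fnd.
Qed.

(** * Translated environments *)

Lemma fnd_tr_env G x : (tr_env G).[? x] = omap (@tr_ty tvar) G.[? x].
Proof. exact: fnd_fmap. Qed.

Lemma tr_env_set G x A : tr_env G.[x <- A] = (tr_env G).[x <- tr_ty A].
Proof.
apply/fmapP => y; rewrite fnd_tr_env !fnd_set fnd_tr_env.
by case: eqP.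
Qed.

Lemma tr_envD G D : tr_env (G + D) = tr_env G + tr_env D.
Proof.
apply/fmapP => x; rewrite fnd_tr_env !fnd_cat !fnd_tr_env.
by case: ifP.
Qed.

Lemma tr_env0 : tr_env [fmap] = [fmap].
Proof. by apply/fmapP => x; rewrite fnd_tr_env !fnd_fmap0. Qed.

Lemma tr_penv_dom xp Th z : z \in domf (tr_penv xp Th) ->
  exists2 p, p \in domf Th & z = xp p.
Proof. by rewrite /tr_penv rekeyE => /rekey_seq_dom [p pTh [<-]]; exists p. Qed.

Lemma tr_penv0 xp : tr_penv xp [fmap] = [fmap].
Proof.
apply: fmap_nil; apply/eqP; rewrite -fsubset0; apply/fsubsetP => z /tr_penv_dom.
by case=> p; rewrite in_fset0.
Qed.

Lemma fnd_tr_penv xp Th p : injective xp ->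
  (tr_penv xp Th).[? xp p] = omap (@tr_ptype tvar) Th.[? p].
Proof.
move=> xp_inj; rewrite /tr_penv rekeyE (@fnd_rekey_seq _ _ _ _ _ _ p) //=.
  by rewrite (fnd_fmap (@tr_ptype tvar)); case: fndP => // pTh; rewrite pTh.
by move=> q _ [/xp_inj].
Qed.

Lemma tr_penv_memE xp Th p : injective xp ->
  (xp p \in domf (tr_penv xp Th)) = (p \in domf Th).
Proof. by move=> xp_inj; rewrite -!fndSome fnd_tr_penv //; case: Th.[? p]. Qed.

(** Outside the range of [xp] both maps are undefined, so the reserved channels decide equality. *)
Lemma xp_fmapP V xp (f g : {fmap chan -> V}) :
  (forall z, z \in domf f -> exists p : pvar, z = xp p) ->
  (forall z, z \in domf g -> exists p : pvar, z = xp p) ->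
  (forall p, f.[? xp p] = g.[? xp p]) -> f = g.
Proof.
move=> fxp gxp fg; apply/fmapP => z.
have [/fxp [p ->] //|zf] := boolP (z \in domf f).
have [/gxp [p ->] //|zg] := boolP (z \in domf g).
by rewrite !not_fnd.
Qed.

Lemma tr_penv_set xp Th p D : injective xp ->
  tr_penv xp Th.[p <- D] = (tr_penv xp Th).[xp p <- tr_ptype D].
Proof.
move=> xp_inj; apply: (@xp_fmapP _ xp) => [z /tr_penv_dom[q]|z|q].
- by exists q.
- rewrite dom_setf => /fset1UP [->|/tr_penv_dom[q]]; first by exists p.
  by exists q.
rewrite fnd_tr_penv // !fnd_set fnd_tr_penv // (inj_eq xp_inj).
by case: eqP.
Qed.

Lemma tr_penvD xp Th Th' : injective xp ->
  tr_penv xp (Th + Th') = tr_penv xp Th + tr_penv xp Th'.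
Proof.
move=> xp_inj; apply: (@xp_fmapP _ xp) => [z /tr_penv_dom[q]|z|q].
- by exists q.
- by rewrite domf_cat => /fsetUP [] /tr_penv_dom[q]; exists q.
by rewrite fnd_tr_penv // !fnd_cat tr_penv_memE // !fnd_tr_penv //; case: ifP.
Qed.

Lemma tr_penv_disjoint xp Th Th' : injective xp ->
  [disjoint domf Th & domf Th'] ->
  [disjoint domf (tr_penv xp Th) & domf (tr_penv xp Th')].
Proof.
move=> xp_inj /fdisjointP dis; apply/fdisjointP => z /tr_penv_dom [p pTh ->].
by rewrite tr_penv_memE // dis.
Qed.

(** Lookups, unlike quantification over a dependent domain, can be rewritten through
    concatenation. *)
Lemma fresh_inP ho (K : choiceType) X (G : {fmap K -> ty ho tvar}) :
  fresh_in X G <-> forall k A, G.[? k] = Some A -> ~ free_tvar X A.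
Proof.
split=> [XG k A|XG k]; last exact: XG (esym (Some_fnd k)).
by case: fndP => // kG [<-]; apply: XG.
Qed.

(** In CP the process environment has moved to the right of the turnstile, so both side conditions
    of [d_all] merge into one on channels. *)
Lemma fresh_in_tr X xp Th G : injective xp ->
  fresh_in_penv X Th -> fresh_in X G -> fresh_in X (tr_penv xp Th + tr_env G).
Proof.
move=> xp_inj XTh /fresh_inP XG; apply/fresh_inP => z A.
rewrite fnd_cat; case: ifP => zG.
  rewrite fnd_tr_env; case Gz: G.[? z] => [B|] //= [<-].
  by move=> fr; exact: XG Gz (free_tvar_tr_ty_pol fr).
have [/tr_penv_dom [p _ ->]|zTh] := boolP (z \in domf (tr_penv xp Th)).
  rewrite fnd_tr_penv //; case: fndP => // pTh [<-].
  by move=> fr; have [l] := free_tvar_tr_ptype fr; apply: XTh.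
by rewrite not_fnd.
Qed.

Lemma all_why_tr G : all_why G -> all_why (tr_env G).
Proof.
move=> whyG x; have [A GA] := whyG x; exists (tr_ty A).
by rewrite ffunE GA.
Qed.

Lemma fresh_notin (s : {fset chan}) : fresh s \notin s.
Proof.
apply/negP => /= fs; suff: (fresh s <= \max_(x <- s) x)%N by rewrite ltnn.
exact: leq_bigmax_seq fs isT.
Qed.

(** * Records as sorted sequences of channels with types *)

Definition env_of (s : seq (chan * ty false tvar)) : env false :=
  foldr (fun q D => D.[q.1 <- q.2]) [fmap] s.

(** Duals appear because each component is linked to a channel of type [q.2] in [env_of]. *)
Definition tensor_of (s : seq (chan * ty false tvar)) : ty false tvar :=
  foldr (fun q B => Tensor (dual q.2) B) One s.

(* The pairs (z_i, tr_ty A_i) for rho = {l_i = z_i} and G = {l_i : A_i}. *)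
Definition record_seq (G : ptype true) (rho : record) (s : seq label)
  : seq (chan * ty false tvar) :=
  pmap (fun l => if (rho.[? l], G.[? l]) is (Some z, Some A)
                 then Some (z, tr_ty A) else None) s.

Lemma mem_env_of s x : (x \in domf (env_of s)) = (x \in unzip1 s).
Proof.
elim: s => [|q s IHs]; first by rewrite inE.
rewrite -[env_of _]/((env_of s).[q.1 <- q.2]) dom_setf in_fset1U IHs.
by rewrite inE.
Qed.

Section Record.
Variables (G : ptype true) (rho : record).
Hypothesis rhoG : fits rho G.

Let fnd_both l : l \in domf rho ->
  exists z A, rho.[? l] = Some z /\ G.[? l] = Some A.
Proof.
case: rhoG => domE _ lrho; have lG : l \in domf G by rewrite -domE.
by exists rho.[lrho], G.[lG]; rewrite !in_fnd.
Qed.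

Let fnd_inj : {in domf rho &, forall l m, rho.[? l] = rho.[? m] -> l = m}.
Proof.
case: rhoG => _ inj l m lrho mrho; rewrite !in_fnd => -[/inj].
by move/(congr1 val).
Qed.

Let ls := labels (domf rho).

Let ls_dom : ls =i domf rho.
Proof. by move=> l; rewrite mem_sort. Qed.

Lemma images_record_seq : images rho = unzip1 (record_seq G rho ls).
Proof.
(* Only this inclusion is kept about [ls], so that the induction can run over its tails; the same
   device recurs below. *)
have: {subset ls <= domf rho} by move=> l; rewrite ls_dom.
rewrite /images -/ls; elim: ls => //= l s IHs sub.
have [z [A [-> ->]]] := fnd_both (sub l (mem_head _ _)).
by rewrite /= IHs // => m ms; apply: sub; rewrite inE ms orbT.
Qed.

Lemma uniq_images : uniq (images rho).
Proof.
(* Under [Some], the [pmap] becomes a plain map of the lookup over the labels where it is defined,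
   and there it is injective. *)
rewrite -(map_inj_uniq (@Some_inj _)) pmapS_filter.
rewrite map_inj_in_uniq ?filter_uniq ?sort_uniq ?fset_uniq // => l m.
rewrite !mem_filter => /andP[_ lls] /andP[_ mls].
by apply: fnd_inj; rewrite -ls_dom.
Qed.

Lemma tr_ptype_record_seq : tr_ptype G = tensor_of (record_seq G rho ls).
Proof.
have: {subset ls <= domf rho} by move=> l; rewrite ls_dom.
have lsE : labels (domf G) = ls by rewrite /ls (proj1 rhoG).
rewrite /tr_ptype /tensors -[labels _]/(labels (domf G)) lsE.
elim: ls => //= l s IHs sub.
have [z [A [-> GA]]] := fnd_both (sub l (mem_head _ _)).
rewrite (fnd_fmap (fun A => tr_ty (dual A))) GA /= tr_ty_dual IHs //.
by move=> m ms; apply: sub; rewrite inE ms orbT.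
Qed.

Lemma send_record_seq x :
  send_record x G rho =
  foldr (fun q Q => free_out x q.1 (dual q.2) Q) (Close x)
    (record_seq G rho ls).
Proof.
have: {subset ls <= domf rho} by move=> l; rewrite ls_dom.
rewrite /send_record -/ls; elim: ls => //= l s IHs sub.
have [z [A [-> ->]]] := fnd_both (sub l (mem_head _ _)).
by rewrite /= tr_ty_dual IHs // => m ms; apply: sub; rewrite inE ms orbT.
Qed.

Lemma tr_env_instantiate :
  tr_env (instantiate G rho) = env_of (record_seq G rho ls).
Proof.
rewrite /instantiate rekeyE (@eq_rekey_seq _ _ _ _ _ _ ls); first last.
- by rewrite -(proj1 rhoG); apply: fnd_inj.
- by move=> l; rewrite ls_dom (proj1 rhoG).
have: {subset ls <= domf rho} by move=> l; rewrite ls_dom.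
elim: ls => /= [|l s IHs sub]; first by rewrite tr_env0.
have [z [A [-> ->]]] := fnd_both (sub l (mem_head _ _)).
by rewrite /= tr_env_set IHs // => m ms; apply: sub; rewrite inE ms orbT.
Qed.

Lemma domf_instantiate : domf (instantiate G rho) =i images rho.
Proof.
by move=> x; rewrite images_record_seq -mem_env_of -tr_env_instantiate.
Qed.

End Record.

(** * CP typing of chains of free outputs and of inputs *)

Lemma derivable_tensor (G D : env false) x y A B P Q :
  y \notin domf G -> x \notin domf G -> x \notin domf D ->
  [disjoint domf G & domf D] ->
  derivable [fmap] P G.[y <- A] -> derivable [fmap] Q D.[x <- B] ->
  derivable [fmap] (Out x (absC y P) Q) (G + D).[x <- Tensor A B].
Proof.
move=> yG xG xD GD [dP] [dQ]; split; rewrite -[[fmap]]cat0f.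
by apply: d_tensor dP dQ; rewrite // fdisjoint0X.
Qed.

Lemma derivable_cut (G D : env false) x y A P Q :
  x \notin domf G -> y \notin domf D -> [disjoint domf G & domf D] ->
  derivable [fmap] P G.[x <- A] -> derivable [fmap] Q D.[y <- dual A] ->
  derivable [fmap] (New A (absC x P) (absC y Q)) (G + D).
Proof.
move=> xG yD GD [dP] [dQ]; split; rewrite -[[fmap]]cat0f.
by apply: d_cut dP dQ; rewrite // fdisjoint0X.
Qed.

(** Each free output is a tensor rule: its left premise is an axiom linking [z] to a fresh name, its
    right premise the rest of the chain. Distinctness of the channels keeps the two environments
    disjoint. *)
Lemma derivable_send x s : x \notin unzip1 s -> uniq (unzip1 s) ->
  derivable [fmap]
    (foldr (fun q Q => free_out x q.1 (dual q.2) Q) (Close x) s)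
    (env_of s).[x <- tensor_of s].
Proof.
elim: s => [|[z A] s IHs] /=; first by split; apply: d_one.
rewrite inE negb_or => /andP[xz xs] /andP[zs us].
have := fresh_notin [fset x; z]; rewrite /free_out; set y := fresh _.
rewrite !inE negb_or => /andP[yx yz].
have -> : (env_of s).[z <- A] = [fmap].[z <- A] + env_of s.
  by rewrite catf_setl_notin ?cat0f // mem_env_of.
apply: derivable_tensor; last exact: IHs.
- by rewrite dom_setf !inE orbF.
- by rewrite dom_setf !inE orbF.
- by rewrite mem_env_of.
- apply/fdisjointP => c; rewrite dom_setf !inE orbF => /eqP ->.
  by rewrite mem_env_of.
(* The link is annotated with [dual A], so the axiom types [z] with a double dual. *)
split; rewrite -[in X in deriv _ _ X.[_ <- _]](dualK A).
by apply: d_axiom; rewrite eq_sym.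
Qed.

(** The innermost [Wait] gives [y] the type [Bot], and each input then absorbs one channel into [y]
    by the par rule. The induction varies [H], since under the input of [z] the environment still
    contains [z]. *)
Lemma derivable_receive y s P (H : env false) :
  y \notin domf H -> y \notin unzip1 s -> uniq (unzip1 s) ->
  {in unzip1 s, forall z, z \notin domf H} ->
  derivable [fmap] P (H + env_of s) ->
  derivable [fmap] (inputs y (unzip1 s) (Wait y P)) H.[y <- dual (tensor_of s)].
Proof.
move=> + + + + dP; elim: s H dP => [|[z A] s IHs] H /= dP yH.
  by move=> _ _ _; case: dP; rewrite catf0 => dP; split; apply: d_bot.
rewrite inE negb_or => /andP[yz ys] /andP[zs us] sH.
have zH : z \notin domf H by apply: sH; rewrite mem_head.
have := IHs H.[z <- A]; rewrite dom_setf in_fset1U negb_or yz yH ys us.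
case=> // [|c cs|].
- by rewrite catf_setl_notin ?mem_env_of // -catf_setr.
- rewrite in_fset1U negb_or sH ?inE ?cs ?orbT // andbT.
  by apply: contraNneq zs => <-.
by rewrite dualK => d; split; apply: d_par.
Qed.

(** Concatenation lets the right map override the left one, so the inner maps may be exchanged only
    when disjoint. *)
Lemma catfACA (K : choiceType) V (a b c d : {fmap K -> V}) :
  [disjoint domf b & domf c] -> (a + b) + (c + d) = (a + c) + (b + d).
Proof. by move=> bc; rewrite !catfA (@disjoint_catfAC _ _ a b c). Qed.

(** * Separation of reserved channels from ordinary ones *)

Section Main.
Variables (xp : pvar -> chan) (xp_inj : injective xp).

Definition apart (S : {fset chan}) := forall p, xp p \notin S.

Lemma apartU S S' : apart (S `|` S') -> apart S /\ apart S'.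
Proof.
by move=> aSS'; split=> p; have := aSS' p; rewrite inE negb_or => /andP[].
Qed.

Lemma apart_set (S : {fset chan}) x : apart (x |` S) ->
  (forall p, xp p != x) /\ apart S.
Proof.
move=> /apartU [ax aG]; split=> // p.
by have := ax p; rewrite inE.
Qed.

Lemma apart_chans Th P G (d : @deriv true Th P G) :
  apart (chans d) -> apart (domf G).
Proof.
have sub : domf G `<=` chans d by case: d => *; apply: fsubsetUl.
by move=> a p; apply: contra (a p); apply: (fsubsetP sub).
Qed.

Lemma notin_penv Th x : (forall p, xp p != x) -> x \notin domf (tr_penv xp Th).
Proof.
move=> ax; apply/negP => /tr_penv_dom [p _ e].
by have := ax p; rewrite e eqxx.
Qed.

Lemma notin_tr Th G x : (forall p, xp p != x) -> x \notin domf G ->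
  x \notin domf (tr_penv xp Th + tr_env G).
Proof. by move=> ax xG; rewrite domf_cat in_fsetU negb_or notin_penv. Qed.

Lemma xp_notin_tr Th G p : apart (domf G) -> p \notin domf Th ->
  xp p \notin domf (tr_penv xp Th + tr_env G).
Proof.
by move=> aG pTh; rewrite domf_cat in_fsetU negb_or tr_penv_memE // pTh aG.
Qed.

Lemma penv_disjoint Th G : apart (domf G) ->
  [disjoint domf (tr_penv xp Th) & domf (tr_env G)].
Proof.
by move=> aG; apply/fdisjointP => z /tr_penv_dom [p _ ->]; apply: aG.
Qed.

Lemma tr_disjoint Th Th' G G' : apart (domf G) -> apart (domf G') ->
  [disjoint domf Th & domf Th'] -> [disjoint domf G & domf G'] ->
  [disjoint domf (tr_penv xp Th + tr_env G)
   & domf (tr_penv xp Th' + tr_env G')].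
Proof.
move=> aG aG' TT GG; rewrite !domf_cat fdisjointUX !fdisjointXU.
rewrite tr_penv_disjoint // penv_disjoint // GG !andbT /=.
by rewrite fdisjoint_sym penv_disjoint.
Qed.

(** The inner summands [tr_env G] and [tr_penv xp Th'] can be exchanged: the first has no reserved
    channels, the second has nothing else. *)
Lemma tr_cat Th Th' G G' : apart (domf G) ->
  (tr_penv xp Th + tr_env G) + (tr_penv xp Th' + tr_env G') =
  tr_penv xp (Th + Th') + tr_env (G + G').
Proof.
move=> aG; rewrite tr_penvD // tr_envD catfACA // fdisjoint_sym.
exact: penv_disjoint.
Qed.

Lemma derivable_receive_record y Th G rho P :
  fits rho G -> apart (domf (instantiate G rho)) ->
  y \notin domf (tr_penv xp Th) -> y \notin domf (instantiate G rho) ->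
  derivable [fmap] P (tr_penv xp Th + tr_env (instantiate G rho)) ->
  derivable [fmap] (receive_record y rho P)
    (tr_penv xp Th).[y <- dual (tr_ptype G)].
Proof.
move=> rhoG aG yTh; rewrite domf_instantiate // => yG.
rewrite tr_env_instantiate // (tr_ptype_record_seq rhoG) /receive_record.
rewrite (images_record_seq rhoG) in yG *; apply: derivable_receive => //.
  by rewrite -images_record_seq // (uniq_images rhoG).
(* The channels of the record are ordinary, those of the translated process environment reserved. *)
move=> z; rewrite -images_record_seq // => zG.
apply/negP => /tr_penv_dom [p _ e].
by move: (aG p); rewrite -e domf_instantiate // zG.
Qed.

End Main.

(** * Rule-by-rule translation of derivations *)

Theorem theorem6p1 (Th : penv true) (P : cproc true) (G : env true)
    (d : deriv Th P G) (xp : pvar -> chan)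
    (xp_inj : injective xp)
    (xp_unused : forall p : pvar, xp p \notin chans d) :
  derivable [fmap] (tr xp d) (tr_penv xp Th + tr_env G).
Proof.
elim: {Th P G} d {xp_unused} (xp_unused : apart xp (chans d)) => /=.
- move=> x y A xy _; rewrite tr_penv0 cat0f !tr_env_set tr_env0 tr_ty_dual.
  by split; apply: d_axiom.
- move=> Th Th' G D x y A P Q xG yD GD TT d1 IH1 d2 IH2.
  case/apartU=> _ /apartU [a1 a2].
  have [ax aG] := apart_set (apart_chans a1).
  have [ay aD] := apart_set (apart_chans a2).
  rewrite -tr_cat //; apply: derivable_cut; rewrite ?notin_tr ?tr_disjoint //.
    by rewrite -catf_setr -tr_env_set; apply: IH1.
  by rewrite -tr_ty_dual -catf_setr -tr_env_set; apply: IH2.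
- move=> Th Th' G D x y A B P Q yG xG xD GD TT d1 IH1 d2 IH2.
  case/apartU=> _ /apartU [a1 a2].
  have [ay aG] := apart_set (apart_chans a1).
  have [ax aD] := apart_set (apart_chans a2).
  rewrite tr_env_set catf_setr -tr_cat //.
  apply: derivable_tensor; rewrite ?notin_tr ?tr_disjoint //.
    by rewrite -catf_setr -tr_env_set; apply: IH1.
  by rewrite -catf_setr -tr_env_set; apply: IH2.
- move=> Th G x y A B P yG xG xy d1 IH1 /apartU [_ a1].
  have [ax /apart_set [ay aG]] := apart_set (apart_chans a1).
  case: (IH1 a1); rewrite !tr_env_set !catf_setr => dP; split.
  by apply: d_par dP; rewrite ?notin_tr.
- move=> Th G x A B P xG d1 IH1 /apartU [_ a1].
  have [ax aG] := apart_set (apart_chans a1).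
  case: (IH1 a1); rewrite !tr_env_set !catf_setr => dP; split.
  by apply: d_plus1 dP; rewrite notin_tr.
- move=> Th G x A B P xG d1 IH1 /apartU [_ a1].
  have [ax aG] := apart_set (apart_chans a1).
  case: (IH1 a1); rewrite !tr_env_set !catf_setr => dP; split.
  by apply: d_plus2 dP; rewrite notin_tr.
- move=> Th G x A B P Q xG d1 IH1 d2 IH2 /apartU [_ /apartU [a1 a2]].
  have [ax aG] := apart_set (apart_chans a1).
  case: (IH1 a1) (IH2 a2); rewrite !tr_env_set !catf_setr => dP [dQ]; split.
  by apply: d_with dP dQ; rewrite notin_tr.
- move=> Th G x y A P yG xG d1 IH1 /apartU [a a1].
  have [ax _] := apart_set a; have [ay aG] := apart_set (apart_chans a1).
  case: (IH1 a1); rewrite !tr_env_set !catf_setr => dP; split.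
  by apply: d_why dP; rewrite notin_tr.
- move=> G x y A P yG xG whyG d1 IH1 /apartU [a a1].
  (* The process environment is empty here, so no reserved channel, whose type would be a tensor or
     a unit, enters the context of the promotion. *)
  case: (IH1 a1); rewrite !tr_env_set tr_penv0 !cat0f => dP; split.
  by apply: d_bang dP => //; apply: all_why_tr.
- move=> Th G x X A B P xG d1 IH1 /apartU [a a1].
  have [ax aG] := apart_set a.
  case: (IH1 a1); rewrite !tr_env_set !catf_setr tr_ty_subst => dP.
  rewrite -[tr_ty (Ex _)]/(Ex (tr_ty (abs_ty X B))) tr_ty_abs; split.
  by apply: d_ex dP; rewrite notin_tr.
- move=> Th G x X B P xG XTh XG d1 IH1 /apartU [a a1].
  have [ax aG] := apart_set a.
  case: (IH1 a1); rewrite !tr_env_set !catf_setr => dP.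
  rewrite -[tr_ty (All _)]/(All (tr_ty (abs_ty X B))) tr_ty_abs; split.
  apply: d_all dP; rewrite ?notin_tr //; last exact: fresh_in_tr.
  by case=> p p0; exfalso; rewrite in_fset0 in p0.
- move=> Th G x A P xG d1 IH1 /apartU [a a1].
  have [ax aG] := apart_set a.
  case: (IH1 a1) => dP; rewrite tr_env_set catf_setr; split.
  by apply: d_weaken; rewrite ?notin_tr.
- move=> Th G x y z A P yG zG yz xG d1 IH1 /apartU [a a1].
  have [ax aG] := apart_set a.
  have [az /apart_set [ay _]] := apart_set (apart_chans a1).
  case: (IH1 a1); rewrite !tr_env_set !catf_setr => dP; split.
  by apply: d_contract dP; rewrite ?notin_tr.
- by move=> x _; rewrite tr_penv0 cat0f tr_env_set tr_env0; split; apply: d_one.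
- move=> Th G x P xG d1 IH1 /apartU [a a1].
  have [ax aG] := apart_set a.
  case: (IH1 a1) => dP; rewrite tr_env_set catf_setr; split.
  by apply: d_bot; rewrite ?notin_tr.
- move=> Th G x xG /apartU [a _]; have [ax aG] := apart_set a.
  rewrite tr_env_set catf_setr; split.
  by apply: d_top; rewrite notin_tr.
- move=> _ p G rho rhoG /apartU [a _].
  rewrite tr_penv_set // tr_penv0 tr_env_instantiate // send_record_seq //.
  (* The channels of the record are those of the conclusion, hence not reserved. *)
  have pG : xp p \notin unzip1 (record_seq G rho (labels (domf rho))).
    by rewrite -images_record_seq // -(domf_instantiate rhoG).
  rewrite catf_setl_notin ?mem_env_of // cat0f (tr_ptype_record_seq rhoG).
  by apply: derivable_send; rewrite // -images_record_seq // (uniq_images rhoG).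
- move=> _ Th Th' G D p rho P Q rhoD _ pTh' TT d1 IH1 d2 IH2.
  case/apartU=> _ /apartU [a1 a2].
  have aG := apart_chans a2; have aD := apart_chans a1.
  set y := fresh _; have : y \notin _ := fresh_notin _.
  rewrite in_fsetU negb_or => /andP [yTh yD].
  (* The abstraction binds all its ordinary channels, so its side of the cut contributes only [Th].
     The sums are arranged to match: [Q] comes first in the cut, with [Th'] and [G], and the other
     side gets the empty channel environment. *)
  have -> : tr_env G = tr_env (G + [fmap]) by rewrite catf0.
  rewrite [Th + Th']disjoint_catfC //.
  rewrite -tr_cat // tr_env0 catf0.
  apply: derivable_cut; rewrite ?xp_notin_tr //.
  + rewrite -[tr_penv xp Th]catf0 -tr_env0 tr_disjoint //.
    * by rewrite fdisjoint_sym.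
    * by rewrite fdisjointX0.
  + rewrite -catf_setl_notin ?aG // -tr_penv_set //; exact: IH2.
  + by apply: derivable_receive_record => //; apply: IH1.
- move=> h Th G x rho P rhoG _ d1 IH1 /apartU [a a1].
  have [ax _] := apart_set a; have aG := apart_chans a1.
  set y := fresh _; have : y \notin _ := fresh_notin _.
  rewrite !in_fsetU !negb_or => /andP [/andP [yx yTh] yG].
  rewrite tr_env_set tr_env0 tr_tySend catf_setr.
  (* The whole of [Th] goes to the receiver of the record; [Close x] is typed with [x : One]
     alone. *)
  apply: derivable_tensor; rewrite ?(notin_penv _ ax) ?in_fset0 ?fdisjointX0 //.
  + by apply: derivable_receive_record => //; apply: IH1.
  + by split; apply: d_one.
- move=> h Th G D x p P xG pTh d1 IH1 /apartU [a a1].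
  have [ax aG] := apart_set a.
  (* The entry for [p] is pulled out of the sum, as it is the channel that the input on [x] binds;
     [x] itself enters at type [Bot] through [Wait]. *)
  case: (IH1 a1); rewrite tr_penv_set // catf_setl_notin ?aG // => dP.
  rewrite tr_env_set tr_tyRecv catf_setr; split.
  apply: d_par (xp_notin_tr _ _ _) (notin_tr _ _ _) _ _; rewrite //.
    by rewrite eq_sym.
  apply: d_bot dP; rewrite dom_setf in_fset1U negb_or notin_tr // andbT.
  by rewrite eq_sym.
Qed.
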